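(* Let $\Lambda\in(0,1)$, $N\ge 1$, and let $(u,v)$ be a solution of $$\begin{cases}-\Delta u=u-u^3-\Lambda uv^2 & \text{in }\mathbb{R}^N\\ -\Delta v=v-v^3-\Lambda u^2v & \text{in }\mathbb{R}^N\\ u,v>0 & \text{in }\mathbb{R}^N.\end{cases}$$ Then $u=v=\frac{1}{\sqrt{1+\Lambda}}$ in $\mathbb{R}^N$.
   Context: A solution is a pair $(u,v)\in L^3_{loc}(\mathbb{R}^N)\times L^3_{loc}(\mathbb{R}^N)$ of real-valued functions solving the system in the sense of distributions. Such solutions are smooth (up to modification on a null set), and pointwise conditions refer to the smooth representatives. *)

(* Defs.v *)
From HB Require Import structures.
From mathcomp Require Import all_boot all_order all_algebra.
From mathcomp Require Import all_classical all_reals all_analysis.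

Set Implicit Arguments.
Unset Strict Implicit.
Unset Printing Implicit Defensive.

Import Order.TTheory GRing.Theory Num.Theory.
Import numFieldNormedType.Exports.

Local Open Scope classical_set_scope.
Local Open Scope ring_scope.

(* The row vectors 'rV[R]_n carry the sigma-algebra generated by the
   coordinates, i.e. the Borel sigma-algebra of R^n; this mirrors the
   library's instance on n.-tuple T. *)
Definition measure_rV_display : measure_display.
Proof. exact: default_measure_display. Qed.

Section measurable_rV.
Context {R : realType} {n : nat}.

Let coors : 'I_n -> 'rV[R]_n -> measurableTypeR R := fun i x => x ord0 i.

Let rV_set0 : g_sigma_preimage coors set0.
Proof. exact: sigma_algebra0. Qed.

Let rV_setC A : g_sigma_preimage coors A -> g_sigma_preimage coors (~` A).
Proof. exact: sigma_algebraC. Qed.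

Let rV_bigcup (F : _^nat) : (forall i, g_sigma_preimage coors (F i)) ->
  g_sigma_preimage coors (\bigcup_i (F i)).
Proof. exact: sigma_algebra_bigcup. Qed.

HB.instance Definition _ := @isMeasurable.Build measure_rV_display
  'rV[R]_n (g_sigma_preimage coors) rV_set0 rV_setC rV_bigcup.

End measurable_rV.

Lemma measurable_coor (R : realType) (n : nat) (i : 'I_n) :
  measurable_fun [set: 'rV[R]_n] (fun x => x ord0 i : measurableTypeR R).
Proof.
move=> _ Y mY; rewrite setTI; apply: sub_sigma_algebra => /=.
rewrite -bigcup_seq/=; exists i => /=; first by rewrite mem_index_enum.
by exists Y => //; rewrite setTI.
Qed.

Lemma measurable_fun_rVP (R : realType) (d : measure_display)
    (T : measurableType d) (n : nat) (f : T -> 'rV[R]_n) :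
  (forall i, measurable_fun [set: T] (fun t => f t ord0 i : measurableTypeR R)) ->
  measurable_fun [set: T] f.
Proof.
move=> mf _ A; apply: (@smallest_sub _ _ _ [set A | measurable (setT `&` f @^-1` A)]).
  split => /=; first by rewrite preimage_set0 setI0.
  - by move=> B; rewrite !setTI => mB; rewrite setTD preimage_setC; exact: measurableC.
  - move=> F mF; rewrite setTI preimage_bigcup; apply: bigcupT_measurable => k.
    by have := mF k; rewrite setTI.
move=> B; rewrite -bigcup_seq => -[i _ [C mC <-]] /=.
by rewrite setTI; exact: (mf i).
Qed.

Definition cons_rV (R : realType) (n : nat)
    (p : measurableTypeR R * 'rV[R]_n) : 'rV[R]_n.+1 :=
  row_mx (p.1%:M : 'rV[R]_1) p.2.

Lemma measurable_cons_rV (R : realType) (n : nat) :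
  measurable_fun setT (@cons_rV R n).
Proof.
apply: measurable_fun_rVP => i.
case: (@split_ordP 1 n i) => j ->.
  rewrite (_ : (fun _ => _) = fst) //.
  by apply/funext => p; rewrite /cons_rV (row_mxEl (p.1%:M : 'rV[R]_1)) mxE !ord1 eqxx.
rewrite (_ : (fun _ => _) =
  (fun x : 'rV[R]_n => x ord0 j : measurableTypeR R) \o snd); last first.
  by apply/funext => p; rewrite /cons_rV (row_mxEr (p.1%:M : 'rV[R]_1)).
by apply: measurableT_comp => //; exact: measurable_coor.
Qed.

Definition leb_cons (R : realType) (n : nat)
    (mu : {measure set 'rV[R]_n -> \bar R}) : {measure set 'rV[R]_n.+1 -> \bar R}.
Proof.
refine (pushforward (lebesgue_measure \x^ mu)%E (@cons_rV R n)).
exact: measurable_cons_rV.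
Defined.

(* Lebesgue measure on R^n, as an n-fold product of the one on R. *)
Fixpoint leb (R : realType) (n : nat) : {measure set 'rV[R]_n -> \bar R} :=
  if n is m.+1 then leb_cons (leb R m) else \d_(0 : 'rV[R]_0).

Lemma leb_box (R : realType) (n : nat) (A : 'I_n -> set (measurableTypeR R)) :
  (forall i, measurable (A i)) ->
  leb R n [set x | forall i, A i (x ord0 i)] =
  (\prod_(i < n) (lebesgue_measure (A i) : \bar R))%E.
Proof.
elim: n A => [|n IH] A mA.
  rewrite big_ord0 /= diracE mem_set//= => -[//].
rewrite big_ord_recl /= /pushforward -(IH (fun i => A (lift ord0 i)))//.
have mB : measurable [set x : 'rV[R]_n | forall i : 'I_n, A (lift ord0 i) (x ord0 i)].
  rewrite (_ : [set x | _] = \big[setI/setT]_(i < n)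
      (setT `&` (fun x : 'rV[R]_n => x ord0 i) @^-1` A (lift ord0 i))).
    by apply: bigsetI_measurable => i _; exact: measurable_coor.
  rewrite -bigcap_seq; apply/seteqP; split => x /= Ax i.
    by move=> _; split => //; exact: Ax.
  by have [] := Ax i (mem_index_enum i).
rewrite -product_measure2E//; congr (_ _).
apply/seteqP; split => -[x y] /= Axy; rewrite /cons_rV /= in Axy *.
  split => [|i].
    have := Axy (@lshift 1 n ord0).
    rewrite (row_mxEl (x%:M : 'rV[R]_1)) mxE eqxx mulr1n.
    by rewrite (_ : @lshift 1 n ord0 = ord0)//; exact/val_inj.
  have := Axy (@rshift 1 n i).
  rewrite (row_mxEr (x%:M : 'rV[R]_1)).
  by rewrite (_ : @rshift 1 n i = lift ord0 i)//; exact/val_inj.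
move=> i; case: (@split_ordP 1 n i) => j ->.
  rewrite (row_mxEl (x%:M : 'rV[R]_1)) mxE !ord1 eqxx mulr1n.
  by rewrite (_ : @lshift 1 n ord0 = ord0)//; [case: Axy|exact/val_inj].
rewrite (row_mxEr (x%:M : 'rV[R]_1)).
by rewrite (_ : @rshift 1 n j = lift ord0 j)//; [case: Axy|exact/val_inj].
Qed.

Section distributions.
Context {R : realType} {N : nat}.
Implicit Types u v f g phi : 'rV[R]_N -> R.

Definition partial (i : 'I_N) f : 'rV[R]_N -> R :=
  fun x => 'D_(delta_mx ord0 i : 'rV[R]_N) f x.

Definition laplacian f : 'rV[R]_N -> R :=
  fun x => \sum_(i < N) partial i (partial i f) x.

(* C^oo: the iterated partial derivatives of all orders exist and are
   (Frechet) differentiable, hence continuous, everywhere. *)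
Definition smooth f : Prop :=
  forall (s : seq 'I_N) (x : 'rV[R]_N), differentiable (foldr partial f s) x.

Definition test_function phi : Prop :=
  smooth phi /\ compact (closure [set x | phi x != 0]).

Definition Lp_loc (p : nat) u : Prop :=
  measurable_fun setT u /\
  forall K : set 'rV[R]_N, compact K ->
    (leb R N).-integrable K (fun x => (`|u x| ^+ p)%:E).

Definition distr_sol_minus_laplacian u g : Prop :=
  forall phi, test_function phi ->
    (\int[leb R N]_x (u x * - laplacian phi x) = \int[leb R N]_x (g x * phi x))%R.

Definition is_solution (Lambda : R) u v : Prop :=
  [/\ Lp_loc 3 u, Lp_loc 3 v,
      distr_sol_minus_laplacian u
        (fun x => u x - u x ^+ 3 - Lambda * u x * v x ^+ 2) &
      distr_sol_minus_laplacian v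
        (fun x => v x - v x ^+ 3 - Lambda * u x ^+ 2 * v x)].

Definition smooth_representative u us : Prop :=
  smooth us /\ {ae leb R N, forall x, u x = us x}.

End distributions.

(* Main.v *)
From HB Require Import structures.
Require Import Defs.
From mathcomp Require Import all_boot all_order all_algebra.
From mathcomp Require Import all_classical all_reals all_analysis.
From mathcomp Require Import measurable_realfun ring lra.

Import Order.TTheory GRing.Theory Num.Theory.
Import numFieldNormedType.Exports.

Local Open Scope classical_set_scope.
Local Open Scope ring_scope.

(* The equations are first shown to hold pointwise: u and v may be replaced by
   their smooth representatives, partial integration against bump functions
   (Fubini and the fundamental theorem of calculus) moves the Laplacian, and a
   continuous function with zero integral against every bump vanishes.

   For the rigidity, let d be r^2 minus the squared distance to a point c.  At
   a maximum of d u, a solution of u^3 - a u <= Delta u satisfies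
   u^2 <= a + O(r^-2); at a maximum of d^3 / v, a positive solution of
   Delta v <= v^3 - b v satisfies v^2 >= b - O(r^-2).  Letting r grow, both
   bounds hold at c without error term.  With A = sup u^2 and B = inf v^2 this
   gives A <= 1 - Lambda B and B >= 1 - Lambda A, hence
   A <= 1 / (1 + Lambda) <= B since Lambda < 1, and the same with u and v
   exchanged. *)

(** * Bounds for entire sub- and supersolutions *)

Lemma is_derive_line {R : realType} {V : normedModType R} {f : V -> R} {x v : V}
    {t d : R} :
  is_derive (x + t *: v) v f d -> is_derive t 1 (fun s => f (x + s *: v)) d.
Proof.
have E : (fun h : R => h^-1 *: (((fun s => f (x + s *: v)) \o shift t) (h *: 1) -
    f (x + t *: v))) =
  (fun h => h^-1 *: ((f \o shift (x + t *: v)) (h *: v) - f (x + t *: v))).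
  apply/funext => h /=; congr (_ *: (f _ - _)).
  by rewrite -[h%:A]/(h * 1) mulr1 scalerDl addrCA addrC.
by case=> D <-; split; rewrite /derivable /derive E.
Qed.

(** Second derivative test on the line through [x]. Fermat's rule gives [df x = 0]; if [d2] were
    positive, [df] would be positive just after [x] and the mean value theorem would make [f] exceed
    [f x] there. *)
Lemma local_max_derive2 {R : realType} {V : normedModType R} (f df : V -> R)
    (v x : V) (d2 : R) :
  (forall y, is_derive y v f (df y)) -> is_derive x v df d2 ->
  (\forall t \near (0 : R), f (x + t *: v) <= f x) -> df x = 0 /\ d2 <= 0.
Proof.
move=> Df D2f /nbhs_ballP[e /= e0 fmax].
have D (t : R) := is_derive_line (Df (x + t *: v)).
have df0 : df x = 0.
  have [||||_] := @derive1_at_max R (fun s => f (x + s *: v)) (- e) e 0.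
  - by rewrite ge0_cp// ltW.
  - by move=> t _; have [] := D t.
  - by rewrite in_itv/= e0 oppr_lt0 e0.
  - move=> t; rewrite in_itv/= -ltr_norml => te; rewrite scale0r addr0.
    by apply: fmax; rewrite /ball/= sub0r normrN.
  by have [_] := D 0; rewrite !scale0r addr0 => -> ->.
split => //; rewrite leNgt; apply/negP => d2gt0.
have D2 : is_derive (0 : R) 1 (fun s => df (x + s *: v)) d2.
  by apply: is_derive_line; rewrite scale0r addr0.
have : (fun h : R => h^-1 *: (df (x + h *: v) - df x)) @ 0^' --> d2.
  have [D2d D2e] := D2; move: D2d; rewrite /derivable => /cvgP.
  move: D2e; rewrite /derive => -> /=.
  rewrite scale0r addr0; under eq_fun do rewrite addr0 -[_%:A]/(_ * 1) mulr1.
  exact.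
rewrite df0 => /cvgrPdist_lt/(_ _ d2gt0); rewrite near_withinE.
move=> /nbhs_ballP[r /= r0 rdf].
(* Halving keeps [h] strictly below both radii: [e], within which [f x] is maximal, and [r], within
   which the difference quotient of [df] is positive. *)
pose h := Num.min e r / 2.
have m0 : 0 < Num.min e r by rewrite lt_min e0.
have h0 : 0 < h by rewrite divr_gt0.
have [me mr] : Num.min e r <= e /\ Num.min e r <= r by rewrite !ge_min !lexx orbT.
have he : h < e by rewrite /h; lra.
have hr : h < r by rewrite /h; lra.
have [|c] := @MVT R (fun s => f (x + s *: v)) (fun s => df (x + s *: v))
    0 h h0 (fun t _ => D t).
  apply: continuous_subspaceT => t.
  by apply/differentiable_continuous/derivable1_diffP; have [] := D t.
rewrite in_itv/= => /andP[c0 ch] E.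
have : f (x + h *: v) <= f x.
  by apply: fmax; rewrite /ball/= sub0r normrN gtr0_norm.
rewrite -subr_le0 -[in f x](addr0 x) -(scale0r v) E subr0 leNgt => /negP; apply.
rewrite mulr_gt0//.
have := rdf c; rewrite /ball/= sub0r normrN gtr0_norm// => /(_ (lt_trans ch hr)).
rewrite gt_eqF// => /(_ isT); rewrite subr0 -[_ *: _]/(_ * _) => H.
have : 0 < c^-1 * df (x + c *: v) by move: H; rewrite ltr_norml => /andP[_]; lra.
by rewrite pmulr_rgt0// invr_gt0.
Qed.

Section cube.
Context {R : realType}.

(** Written as a product of segments, so that compactness comes from the factors and the volume from
    [leb_box]. *)
Definition cube n (c : 'rV[R]_n) (d : R) : set 'rV[R]_n :=
  [set x | forall i, `[c ord0 i - d, c ord0 i + d]%classic (x ord0 i)].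

Lemma cubeP n (c : 'rV[R]_n) d x :
  cube n c d x <-> forall i, `|x ord0 i - c ord0 i| <= d.
Proof.
by split=> H i; have := H i; rewrite /= in_itv/= -ler_distlC distrC.
Qed.

Lemma compact_cube n (c : 'rV[R]_n) (d : R) : compact (cube n c d).
Proof.
apply: (@rV_compact R n (fun i => `[c ord0 i - d, c ord0 i + d]%classic)) => i.
exact: segment_compact.
Qed.

Lemma closed_cube n (c : 'rV[R]_n) (d : R) : closed (cube n c d).
Proof. exact: (compact_closed (@norm_hausdorff _ 'rV[R]_n) (compact_cube n c d)). Qed.

End cube.

(** * Maximum principle with a quadratic cut-off *)

Section entire_bounds.
Context {R : realType} {N : nat}.
Implicit Types (u : 'rV[R]_N -> R) (x c : 'rV[R]_N).

Lemma is_derive_coord (x v : 'rV[R]_N) (j : 'I_N) :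
  is_derive x v (fun y : 'rV[R]_N => y ord0 j) (v ord0 j).
Proof.
have D : derivable (@id 'rV[R]_N) x v by exact: derivable_id.
split; first exact: (derivable_mxP _ _ _).1 D ord0 j.
by have /(congr1 (fun M : 'rV[R]_N => M ord0 j)) := derive_mx D; rewrite mxE derive_id.
Qed.

Lemma smooth_continuous u : smooth u -> continuous u.
Proof. by move=> su x; exact: differentiable_continuous (su [::] x). Qed.

Lemma smooth_partial u (i : 'I_N) : smooth u -> smooth (partial i u).
Proof. by move=> su s x; have := su (rcons s i) x; rewrite -cats1 foldr_cat. Qed.

Lemma smooth_is_derive u (i : 'I_N) x : smooth u ->
  is_derive x (delta_mx ord0 i) u (partial i u x).
Proof. by move=> su; apply/derivableP/diff_derivable; exact: (su [::]). Qed.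

(** A polynomial cut-off, positive exactly inside a Euclidean ball; the sup norm of row vectors
    would not be differentiable. *)
Definition depth (r : R) c x : R := r ^+ 2 - \sum_(j < N) (x ord0 j - c ord0 j) ^+ 2.

Lemma depth_center r c : depth r c c = r ^+ 2.
Proof. by rewrite /depth big1 ?subr0// => j _; rewrite subrr expr0n. Qed.

Lemma depth_le r c x : depth r c x <= r ^+ 2.
Proof. by rewrite gerBl sumr_ge0// => j _; exact: sqr_ge0. Qed.

(** Point-free form, on which the differentiation rules for sums and powers can act. *)
Lemma depthE r c : depth r c = cst (r ^+ 2) -
    \sum_(j < N) ((fun y : 'rV[R]_N => y ord0 j) - cst (c ord0 j)) ^+ 2.
Proof. by apply/funext => y; rewrite /depth /cst !fctE fct_sumE. Qed.

Lemma is_derive_depth r c x (i : 'I_N) :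
  is_derive x (delta_mx ord0 i) (depth r c) (- 2 * (x ord0 i - c ord0 i)).
Proof.
rewrite depthE.
have H j := is_derive_coord x (delta_mx ord0 i) j.
apply: is_derive_eq; rewrite sub0r (bigD1 i)//= big1 ?addr0.
  by rewrite !mxE !eqxx subr0 expr1 /GRing.scale/= !fctE; ring.
by move=> j ji; rewrite mxE eqxx (negbTE ji) subr0 scaler0.
Qed.

Lemma continuous_depth r c : continuous (depth r c).
Proof.
move=> x; apply: differentiable_continuous; rewrite depthE.
apply: differentiableB => //; apply: differentiable_sum => j.
by apply: differentiableX; apply: differentiableB => //; exact: differentiable_coord.
Qed.

(** The closed ball [0 <= depth r c x] is compact, being closed and contained in the cube of
    half-side [r]. *)
Lemma depth_max (r : R) c (f : 'rV[R]_N -> R) : 0 < r -> continuous f ->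
  exists2 x, 0 <= depth r c x &
    forall y, 0 <= depth r c y -> f y <= f x.
Proof.
move=> r0 cf; pose K := [set x | 0 <= depth r c x].
have K0 : K !=set0 by exists c; rewrite /K/= depth_center sqr_ge0.
have cK : compact K.
  apply: (subclosed_compact _ (compact_cube N c r)).
    apply: (@preimage_closed _ _ (depth r c) [set t | 0 <= t]) => [x _|].
      exact: continuous_depth.
    by have := @closed_ge R 0.
  move=> x; rewrite /K/= => Kx; apply/cubeP => i.
  rewrite -ler_sqr ?nnegrE// ?(ltW r0)// real_normK ?num_real//.
  apply: (@le_trans _ _ (\sum_(j < N) (x ord0 j - c ord0 j) ^+ 2)).
    rewrite (bigD1 i)//= lerDl sumr_ge0// => j _; exact: sqr_ge0.
  by rewrite -subr_ge0.
have [x xK xmax] := EVT_max_rV K0 cK (continuous_subspaceT cf).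
by exists x => [|y Ky]; [move: xK; rewrite inE|apply: xmax; rewrite inE].
Qed.

Lemma arch_le (a b k : R) : 0 <= k ->
  (forall r, 0 < r -> a * r ^+ 2 <= b * r ^+ 2 + k) -> a <= b.
Proof.
move=> k0 H; rewrite leNgt; apply/negP; rewrite -subr_gt0 => ab.
(* This radius gives [(a - b) * r > k], and [r >= 1] gives [r ^+ 2 >= r]. *)
pose r := k / (a - b) + 1.
have r1 : 1 <= r by rewrite lerDr divr_ge0// ltW.
have r0 : 0 < r by rewrite (lt_le_trans ltr01).
have := H _ r0; apply/negP; rewrite -ltNge -subr_gt0 opprD addrA -mulrBl subr_gt0.
have rab : k < (a - b) * r by rewrite /r mulrDr mulr1 mulrC divfK ?gt_eqF// ltrDl.
by rewrite (lt_le_trans rab)// ler_pM2l// expr2 ler_peMr// ltW.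
Qed.

Lemma is_derive_coordB (x : 'rV[R]_N) c (i : 'I_N) :
  is_derive x (delta_mx ord0 i) (fun y : 'rV[R]_N => - 2 * (y ord0 i - c ord0 i)) (- 2).
Proof.
have H := is_derive_coord x (delta_mx ord0 i) i.
have -> : (fun y : 'rV[R]_N => - 2 * (y ord0 i - c ord0 i)) =
  - 2 *: ((fun y : 'rV[R]_N => y ord0 i) - cst (c ord0 i)) by [].
by apply: is_derive_eq; rewrite mxE !eqxx subr0 /GRing.scale/= mulr1.
Qed.

Lemma sum_const (k : R) : \sum_(i < N) k = N%:R * k.
Proof. by rewrite sumr_const card_ord mulr_natl. Qed.

(** At a maximum of [depth * u], with values [d] and [w] of the factors, the two derivative
    conditions give [d ^+ 2 * w ^+ 2 <= a * d ^+ 2 + (2 * N%:R + 8) * r ^+ 2]. Since [d * w] is at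
    least its value [r ^+ 2 * u c] at the centre and [d <= r ^+ 2], dividing by [r ^+ 2] leaves an
    error independent of [r]. *)
Lemma subsolution_le u (a : R) : smooth u -> (forall x, 0 < u x) -> 0 <= a ->
  (forall x, u x ^+ 3 - a * u x <= laplacian u x) -> forall x, u x ^+ 2 <= a.
Proof.
move=> su u0 a0 usub c; apply: (@arch_le _ _ (2 * N%:R + 8)) => [|r r0].
  by rewrite addr_ge0// mulr_ge0.
have cu := smooth_continuous u su.
have [|x rx xmax] := depth_max r c (fun x => depth r c x * u x) r0.
  by move=> x; apply: continuousM (continuous_depth r c x) (cu x).
have xc : r ^+ 2 * u c <= depth r c x * u x.
  by rewrite -(depth_center r c); apply: xmax; rewrite depth_center sqr_ge0.
have rx0 : 0 < depth r c x.
  by rewrite -(pmulr_lgt0 _ (u0 x)) (lt_le_trans _ xc)// mulr_gt0 ?exprn_gt0.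
(* Outside the ball [depth] is negative and [u] positive, so the maximum over the ball is global. *)
have {}xmax y : depth r c y * u y <= depth r c x * u x.
  have [/xmax//|ry] := leP 0 (depth r c y).
  by rewrite (@le_trans _ _ 0)// ?ltW ?mulr_gt0 ?pmulr_llt0.
have key i : depth r c x ^+ 2 * partial i (partial i u) x <=
    2 * u x * depth r c x + 8 * (x ord0 i - c ord0 i) ^+ 2 * u x.
  have D1 y : is_derive y (delta_mx ord0 i) (fun x => depth r c x * u x)
     (depth r c y * partial i u y + u y * (- 2 * (y ord0 i - c ord0 i))).
    have := is_derive_depth r c y i; have := smooth_is_derive u i y su.
    by move=> ? ?; exact: is_deriveM.
  have D2 : is_derive x (delta_mx ord0 i)
      (fun y => depth r c y * partial i u y + u y * (- 2 * (y ord0 i - c ord0 i)))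
     (depth r c x * partial i (partial i u) x
      + partial i u x * (- 2 * (x ord0 i - c ord0 i))
      + (u x * (- 2) + (- 2 * (x ord0 i - c ord0 i)) * partial i u x)).
    have := is_derive_depth r c x i; have := smooth_is_derive u i x su.
    have := smooth_is_derive _ i x (smooth_partial u i su).
    have := is_derive_coordB x c i => ? ? ? ?.
    by apply: is_deriveD; exact: is_deriveM.
  have [|d1 dd] := local_max_derive2 _ _ _ _ _ D1 D2.
    by near=> t; exact: xmax.
  have := ler_wpM2l (ltW rx0) dd.
  move: d1 {dd}rx0 {D1 D2 xmax xc}; move: (depth r c x) (u x) (partial i u x)
    (partial i (partial i u) x) (x ord0 i - c ord0 i).
  move=> d w w1 w2 y /eqP; rewrite addr_eq0 => /eqP d1 _.
  rewrite mulr0 => d2.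
  (* The first-order condition [d * w1 = 2 * w * y] eliminates the gradient of [u] from the
     second-order one, once that is multiplied by [d]. *)
  have E : d * w1 * y = 2 * w * y ^+ 2 by rewrite d1; ring.
  have -> : d ^+ 2 * w2 = d * (d * w2 + w1 * (- 2 * y) + (w * (- 2) + - 2 * y * w1))
      + 2 * w * d + 4 * (d * w1 * y) by ring.
  by rewrite E; lra.
have {key} : depth r c x ^+ 2 * laplacian u x <=
    2 * N%:R * u x * depth r c x + 8 * (r ^+ 2 - depth r c x) * u x.
  rewrite /laplacian mulr_sumr (le_trans (ler_sum _ (fun i _ => key i)))//.
  rewrite big_split/= sum_const -mulr_suml -mulr_sumr /depth; lra.
have := usub x; move: (laplacian u x) => L uL key.
have := depth_le r c x; move: xc rx0 key uL (u0 x) (u0 c).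
move: (depth r c x) (u x) (u c) => d w z zw d0 key wL w0 z0 dr.
have K1 : d ^+ 2 * (w ^+ 3 - a * w) <= (2 * N%:R + 8) * r ^+ 2 * w.
  rewrite (le_trans (ler_wpM2l (sqr_ge0 d) wL))// (le_trans key)//.
  have NR : 0 <= N%:R :> R by [].
  have := mulr_ge0 NR (mulr_ge0 (ltW w0) (_ : 0 <= r ^+ 2 - d)).
  rewrite subr_ge0 => /(_ dr); have := mulr_gt0 d0 w0; nra.
have K2 : d ^+ 2 * w ^+ 2 <= a * d ^+ 2 + (2 * N%:R + 8) * r ^+ 2.
  by rewrite -(ler_pM2r w0); nra.
have rr : 0 < r ^+ 2 by rewrite exprn_gt0.
have K3 : (r ^+ 2 * z) ^+ 2 <= (d * w) ^+ 2.
  by rewrite ler_sqr ?nnegrE ?mulr_ge0// ltW.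
have K4 : d ^+ 2 <= (r ^+ 2) ^+ 2 by rewrite ler_sqr ?nnegrE// ltW.
have K5 := ler_wpM2l a0 K4.
rewrite -(ler_pM2r rr); nra.
Unshelve. all: by end_near. Qed.

(* Where [depth ^ 3 / v] is maximal on a ball, [laplacian (depth ^ 3)] is at
   most a multiple of [laplacian v], while [depth ^ 3] is a subsolution of an
   eigenvalue equation whose eigenvalue tends to [0] as the radius grows. *)
Lemma supersolution_ge u (b : R) : smooth u -> (forall x, 0 < u x) ->
  (forall x, laplacian u x <= u x ^+ 3 - b * u x) -> forall x, b <= u x ^+ 2.
Proof.
(* The constant comes from completing the square: with [k = 6 * N%:R + 24], [k * d * r ^+ 2 - 24 * r
   ^+ 4 <= k ^+ 2 / 96 * d ^+ 2], which is the nonnegativity of [(k * d - 48 * r ^+ 2) ^+ 2]. *)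
move=> su u0 usup c; apply: (@arch_le _ _ ((6 * N%:R + 24) ^+ 2 / 96)) => [|r r0].
  by rewrite divr_ge0// sqr_ge0.
have cu := smooth_continuous u su.
have [|x rx xmax] := depth_max r c (fun x => depth r c x ^+ 3 / u x) r0.
  move=> x; apply: (@continuousM _ _ (fun x => depth r c x ^+ 3) (fun x => (u x)^-1)).
    exact: continuous_comp (continuous_depth r c x) (@exprn_continuous _ 3 _).
  by apply: continuousV (cu x); rewrite gt_eqF.
have xc : (r ^+ 2) ^+ 3 / u c <= depth r c x ^+ 3 / u x.
  by rewrite -(depth_center r c); apply: xmax; rewrite depth_center sqr_ge0.
set M := depth r c x ^+ 3 / u x in xc xmax.
have M0 : 0 < M by rewrite (lt_le_trans _ xc)// divr_gt0 ?exprn_gt0.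
have ME : M * u x = depth r c x ^+ 3 by rewrite /M divfK// gt_eqF.
have rx0 : 0 < depth r c x.
  rewrite lt_neqAle rx andbT eq_sym; apply/eqP => d0.
  by move: M0; rewrite /M d0 expr0n/= mul0r ltxx.
(* Maximality of the quotient is restated as [depth ^ 3 - M * u <= 0] with equality at [x], so no
   quotient has to be differentiated. Outside the ball the odd power is negative. *)
have {}xmax y : depth r c y * (depth r c y * depth r c y) - M * u y <= 0.
  rewrite -expr2 -exprS subr_le0; have [/xmax|ry] := leP 0 (depth r c y).
    by rewrite ler_pdivrMr.
  apply: (@le_trans _ _ 0); first by rewrite exprn_odd_le0// ltW.
  by rewrite ltW// mulr_gt0.
(* The left-hand side is the second partial derivative of [depth ^ 3]. *)
have key i : - 6 * depth r c x ^+ 2 + 24 * depth r c x * (x ord0 i - c ord0 i) ^+ 2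
    <= M * partial i (partial i u) x.
  pose D (y : 'rV[R]_N) : R := - 2 * (y ord0 i - c ord0 i).
  have D1 y : is_derive y (delta_mx ord0 i)
      (fun x => depth r c x * (depth r c x * depth r c x) - M * u x)
      (3 * (depth r c y * (depth r c y * D y)) - M * partial i u y).
    have ? := is_derive_depth r c y i; have ? := smooth_is_derive u i y su.
    have H : is_derive y (delta_mx ord0 i)
        ((depth r c * (depth r c * depth r c)) - M *: u)
        (3 * (depth r c y * (depth r c y * D y)) - M * partial i u y).
      by apply: is_derive_eq; rewrite /D !fctE /GRing.scale/=; ring.
    exact: H.
  have D2 : is_derive x (delta_mx ord0 i)
      (fun y => 3 * (depth r c y * (depth r c y * D y)) - M * partial i u y)
      (- 6 * depth r c x ^+ 2 + 24 * depth r c x * (x ord0 i - c ord0 i) ^+ 2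
       - M * partial i (partial i u) x).
    have ? := is_derive_depth r c x i.
    have ? := smooth_is_derive _ i x (smooth_partial u i su).
    have ? : is_derive x (delta_mx ord0 i) D (- 2) := is_derive_coordB x c i.
    have H : is_derive x (delta_mx ord0 i)
        (3 *: (depth r c * (depth r c * D)) - M *: partial i u)
      (- 6 * depth r c x ^+ 2 + 24 * depth r c x * (x ord0 i - c ord0 i) ^+ 2
       - M * partial i (partial i u) x).
      by apply: is_derive_eq; rewrite /D !fctE /GRing.scale/=; ring.
    exact: H.
  have [|_] := local_max_derive2 _ _ _ _ _ D1 D2; last by rewrite subr_le0.
  by near=> t; rewrite ME -expr2 -exprS subrr; exact: xmax.
have {key} : - 6 * N%:R * depth r c x ^+ 2
     + 24 * depth r c x * (r ^+ 2 - depth r c x) <= M * laplacian u x.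
  rewrite /laplacian mulr_sumr (le_trans _ (ler_sum _ (fun i _ => key i)))//.
  rewrite big_split/= sum_const -mulr_sumr /depth; lra.
have := usup x; move: (laplacian u x) => L uL key.
have := depth_le r c x; move: xc rx0 M0 ME key uL (u0 x) (u0 c).
rewrite /M {M xmax}; move: (depth r c x) (u x) (u c) => d w z.
set M := d ^+ 3 / w => xc d0 M0 ME key wL w0 z0 dr.
have rr : 0 < r ^+ 2 by rewrite exprn_gt0.
(* As [d ^+ 3] is at most its value at the centre, the quotient can only be maximal at [x] if
   [u x <= u c]; a lower bound at [x] therefore passes to [c]. *)
have wz : w <= z.
  move: xc; rewrite ler_pdivrMr// mulrAC ler_pdivlMr// => H.
  have H3 : d ^+ 3 <= (r ^+ 2) ^+ 3 by rewrite ler_pXn2r// nnegrE ltW.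
  rewrite -(ler_pM2l (_ : 0 < (r ^+ 2) ^+ 3)) ?exprn_gt0//.
  by rewrite (le_trans H)// ler_wpM2r// ltW.
have K1 : d * (- 6 * N%:R * d + 24 * (r ^+ 2 - d)) <= d * (d ^+ 2 * (w ^+ 2 - b)).
  have -> : d * (d ^+ 2 * (w ^+ 2 - b)) = M * (w ^+ 3 - b * w).
    by rewrite mulrA -exprS -ME; ring.
  by rewrite (le_trans _ (ler_wpM2l (ltW M0) wL))// (le_trans _ key)//; lra.
rewrite ler_pM2l// in K1.
have K2 : w ^+ 2 <= z ^+ 2 by rewrite ler_sqr// nnegrE ltW.
rewrite (@le_trans _ _ (w ^+ 2 * r ^+ 2 + (6 * N%:R + 24) ^+ 2 / 96))//; last first.
  by rewrite lerD2r ler_wpM2r// ltW.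
have d2 : 0 < d ^+ 2 by rewrite exprn_gt0.
rewrite -(ler_pM2r d2) -subr_ge0.
have K3 := ler_wpM2l (ltW rr) K1.
have := sqr_ge0 ((6 * N%:R + 24) * d - 48 * r ^+ 2).
move: K3; lra.
Unshelve. all: by end_near. Qed.

Lemma coupled_bounds (L : R) (u v : 'rV[R]_N -> R) : 0 < L -> L < 1 ->
  smooth u -> smooth v -> (forall x, 0 < u x) -> (forall x, 0 < v x) ->
  (forall x, - laplacian u x = u x - u x ^+ 3 - L * u x * v x ^+ 2) ->
  (forall x, - laplacian v x = v x - v x ^+ 3 - L * u x ^+ 2 * v x) ->
  forall x, u x ^+ 2 <= (1 + L)^-1 <= v x ^+ 2.
Proof.
move=> L0 L1 su sv u0 v0 eu ev.
(* Dropping the coupling term, which has a sign, gives a first bound; it makes the supremum [A]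
   finite and, through [B <= 1], the constant [1 - L * B] nonnegative. *)
have v2_le1 : forall x, v x ^+ 2 <= 1.
  apply: subsolution_le => // x; have := ev x.
  have : 0 <= L * u x ^+ 2 * v x by rewrite !mulr_ge0 ?sqr_ge0// ltW.
  lra.
have u2_le1 : forall x, u x ^+ 2 <= 1.
  apply: subsolution_le => // x; have := eu x.
  have : 0 <= L * u x * v x ^+ 2 by rewrite !mulr_ge0 ?sqr_ge0// ltW.
  lra.
pose A := sup (range (fun x => u x ^+ 2)); pose B := inf (range (fun x => v x ^+ 2)).
have uA x : u x ^+ 2 <= A.
  by apply: ub_le_sup; [exists 1 => _ [y _ <-]|exists x].
have vB x : B <= v x ^+ 2.
  by apply: ge_inf; [exists 0 => _ [y _ <-]; exact: sqr_ge0|exists x].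
have AB : A <= 1 - L * B.
  apply: ge_sup; first by exists (u 0 ^+ 2), 0.
  move=> _ [y _ <-]; apply: (subsolution_le u) => // [|x].
    by have := vB 0; have := v2_le1 0; nra.
  have : 0 <= L * u x * (v x ^+ 2 - B) by rewrite !mulr_ge0 ?subr_ge0// ltW.
  by have := eu x; lra.
have BA : 1 - L * A <= B.
  apply: lb_le_inf; first by exists (v 0 ^+ 2), 0.
  move=> _ [y _ <-]; apply: (supersolution_ge v) => // x.
  have : 0 <= L * v x * (A - u x ^+ 2) by rewrite !mulr_ge0 ?subr_ge0// ltW.
  by have := ev x; lra.
have L1p : 0 < 1 + L by lra.
(* Inserting each inequality into the other gives [(1 - L ^+ 2) * A <= 1 - L <= (1 - L ^+ 2) * B],
   and [1 - L] is positive. *)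
have AL : A <= (1 + L)^-1 by rewrite -div1r ler_pdivlMr//; nra.
have BL : (1 + L)^-1 <= B by rewrite -div1r ler_pdivrMr//; nra.
by move=> x; rewrite (le_trans (uA x) AL) (le_trans BL (vB x)).
Qed.

Lemma coupled_liouville (L : R) (u v : 'rV[R]_N -> R) : 0 < L -> L < 1 ->
  smooth u -> smooth v -> (forall x, 0 < u x) -> (forall x, 0 < v x) ->
  (forall x, - laplacian u x = u x - u x ^+ 3 - L * u x * v x ^+ 2) ->
  (forall x, - laplacian v x = v x - v x ^+ 3 - L * u x ^+ 2 * v x) ->
  forall x, u x = 1 / Num.sqrt (1 + L) /\ v x = 1 / Num.sqrt (1 + L).
Proof.
move=> L0 L1 su sv u0 v0 eu ev x.
have /andP[uL vL] := coupled_bounds L u v L0 L1 su sv u0 v0 eu ev x.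
(* The system is symmetric under exchanging [u] and [v], up to the order of factors. *)
have /andP[vL' uL'] : v x ^+ 2 <= (1 + L)^-1 <= u x ^+ 2.
  apply: coupled_bounds => // y; first by rewrite ev; ring.
  by rewrite eu; ring.
have L1p : 0 < 1 + L by lra.
have E (w : R) : 0 < w -> w ^+ 2 <= (1 + L)^-1 -> (1 + L)^-1 <= w ^+ 2 ->
    w = 1 / Num.sqrt (1 + L).
  move=> w0 wl wr; rewrite div1r -sqrtrV ?ltW//.
  have -> : (1 + L)^-1 = w ^+ 2 by apply/eqP; rewrite eq_le wl wr.
  by rewrite sqrtr_sqr gtr0_norm.
by split; apply: E.
Qed.

End entire_bounds.

(** * Bump functions *)

Section flat.
Context {R : realType}.
Implicit Types (p : {poly R}) (t : R).

(** The polynomial factor in [t^-1] makes the family of these flat functions closed under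
    differentiation; [p = 1] is the classical one. *)
Definition flat p t : R := if 0 < t then p.[t^-1] * expR (- t^-1) else 0.

Lemma flat_le0 p t : t <= 0 -> flat p t = 0.
Proof. by move=> t0; rewrite /flat ltNge t0. Qed.

Lemma poly_growth p : exists C n, 0 <= C /\ forall s, 1 <= s -> `|p.[s]| <= C * s ^+ n.
Proof.
elim/poly_ind: p => [|p k [C [n [C0 H]]]].
  by exists 0, 0%N; split => // s _; rewrite horner0 normr0 mul0r.
exists (C + `|k|), n.+1; split; first by rewrite addr_ge0.
move=> s s1; rewrite hornerMXaddC (le_trans (ler_normD _ _))// mulrDl lerD//.
  rewrite normrM (ger0_norm (le_trans ler01 s1)) exprSr mulrA.
  by rewrite ler_wpM2r ?H// (le_trans ler01).
by rewrite ler_peMr// exprn_ege1.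
Qed.

(** If [p] grows like the [n]-th power, the term of order [n.+2] in the exponential series of [t^-1]
    outgrows it by two powers. Quadratic decay is what yields derivative [0] at the origin. *)
Lemma flat_quadratic p : exists2 C, 0 <= C &
  forall t, 0 < t <= 1 -> `|flat p t| <= C * t ^+ 2.
Proof.
have [C [n [C0 H]]] := poly_growth p.
exists (C * n.+2`!%:R); first by rewrite mulr_ge0.
move=> t /andP[t0 t1]; rewrite /flat t0 normrM (gtr0_norm (expR_gt0 _)).
have s1 : 1 <= t^-1 by rewrite invf_ge1.
have s0 := lt_le_trans ltr01 s1.
rewrite expRN ler_pdivrMr ?expR_gt0// (le_trans (H _ s1))//.
rewrite -!mulrA ler_wpM2l//.
have := @expR_ge1Dxn R t^-1 n.+1 (ltW s0) => e1.
have {e1} : t^-1 ^+ n.+2 / n.+2`!%:R <= expR t^-1 by rewrite (le_trans _ e1)// lerDr.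
rewrite ler_pdivrMr ?ltr0n ?fact_gt0// => e1.
have sn0 : 0 < t^-1 ^+ 2 by rewrite exprn_gt0.
rewrite -(ler_pM2r sn0) -exprD addn2 (le_trans e1)// le_eqVlt; apply/orP; left.
apply/eqP; move: (expR _) (n.+2`!%:R) => E F.
by field; rewrite gt_eqF.
Qed.

Lemma is_derive_flat p t : is_derive t 1 (flat p) (flat ('X^2 * (p - p^`())) t).
Proof.
have [t0|t0|->] := ltgtP t 0.
- rewrite flat_le0 ?ltW//; apply: (@near_eq_is_derive _ _ _ (cst 0)).
    by near=> s; rewrite flat_le0// ltW//; near: s; exact: lt_nbhsl.
- apply: (@near_eq_is_derive R R R (fun s : R => p.[s^-1] * expR (- s^-1))).
    by near=> s; rewrite /flat ifT//; near: s; exact: lt_nbhsr.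
  have tn0 : t != 0 by rewrite gt_eqF.
  have Di : is_derive t 1 GRing.inv (- t ^- 2 *: 1) by exact: is_deriveV.
  have Dp : is_derive t 1 (horner p \o GRing.inv) (- t ^- 2 * p^`().[t^-1]).
    apply: is_derive_eq.
    by rewrite /GRing.scale/=; ring.
  have De : is_derive t 1 (expR \o (- GRing.inv)) (t ^- 2 * expR (- t^-1)).
    apply: is_derive_eq.
    by rewrite /GRing.scale/=; ring.
  rewrite (_ : (fun s => _) = (horner p \o GRing.inv) * (expR \o (- GRing.inv)))//.
  apply: is_derive_eq; rewrite /flat t0 hornerM hornerXn hornerD hornerN.
  by rewrite /GRing.scale/= !fctE exprVn; ring.
- have [C C0 HC] := flat_quadratic p; rewrite (flat_le0 _ 0)//.
  suff H : (fun h : R => h^-1 *: (flat p (h *: 1 + 0) - flat p 0)) @ 0^' --> (0 : R).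
    by split; [exact: cvgP H|exact: cvg_lim H].
  apply/cvgrPdist_lt => e e0; near=> h.
  rewrite addr0 -[h%:A]/(h * 1) mulr1 (flat_le0 _ 0)// subr0 sub0r normrN.
  have [h0|h0] := leP h 0; first by rewrite flat_le0// scaler0 normr0.
  have h1 : h <= 1.
    by apply: ltW; near: h; apply: nbhs_dnbhs; apply: lt_nbhsl.
  rewrite normrZ normfV gtr0_norm// ltr_pdivrMl//.
  rewrite (le_lt_trans (HC h _)) ?h0// expr2 mulrCA ltr_pM2l//.
  (* Adding [1] keeps the denominator positive when [C] is [0]. *)
  suff : h < e / (C + 1).
    rewrite ltr_pdivlMr ?ltr_wpDl// => he; rewrite (le_lt_trans _ he)//.
    by rewrite mulrC ler_pM2l// lerDl.
  by near: h; apply: nbhs_dnbhs; apply: lt_nbhsl; rewrite divr_gt0// ltr_wpDl.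
Unshelve. all: by end_near. Qed.
End flat.

Section bump.
Context {R : realType} {N : nat}.
Implicit Types (f g : 'rV[R]_N -> R) (c x : 'rV[R]_N).

(* An algebra of functions that is visibly closed under partial derivatives. *)
Inductive flat_algebra : ('rV[R]_N -> R) -> Prop :=
| flat_algebra_cst k : flat_algebra (cst k)
| flat_algebra_add f g : flat_algebra f -> flat_algebra g -> flat_algebra (f + g)
| flat_algebra_mul f g : flat_algebra f -> flat_algebra g -> flat_algebra (f * g)
| flat_algebra_flat p j a b : flat_algebra (fun x => flat p (a * x ord0 j + b)).

Lemma is_derive_affine_coord (x v : 'rV[R]_N) (j : 'I_N) (a b : R) :
  is_derive x v (fun y : 'rV[R]_N => a * y ord0 j + b) (a * v ord0 j).
Proof.
have H := is_derive_coord x v j.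
have -> : (fun y : 'rV[R]_N => a * y ord0 j + b) =
  a *: (fun y : 'rV[R]_N => y ord0 j) + cst b by [].
by apply: is_derive_eq; rewrite addr0.
Qed.

Lemma differentiable_affine_coord x (j : 'I_N) (a b : R) :
  differentiable (fun y : 'rV[R]_N => a * y ord0 j + b) x.
Proof.
have -> : (fun y : 'rV[R]_N => a * y ord0 j + b) =
  a *: (fun y : 'rV[R]_N => y ord0 j) + cst b by [].
by apply: differentiableD => //; apply: differentiableZ; exact: differentiable_coord.
Qed.

(** Differentiability and closure go through one induction, since the sum and product rules need
    differentiable operands. On the generators closure is the chain rule with [is_derive_flat]. *)
Lemma flat_algebra_partial f : flat_algebra f ->
  (forall x, differentiable f x) /\ forall i, flat_algebra (partial i f).
Proof.
elim => {f} [k|f g _ [df pf] _ [dg pg]|f g Ff [df pf] Fg [dg pg]|p j a b].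
- split=> // i; rewrite (_ : partial i _ = cst 0); first exact: flat_algebra_cst.
  by apply/funext => x; rewrite /partial derive_cst.
- split=> [x|i]; first exact: differentiableD.
  rewrite (_ : partial i _ = partial i f + partial i g); first exact: flat_algebra_add.
  by apply/funext => x; rewrite /partial deriveD//; exact: diff_derivable.
- split=> [x|i]; first exact: differentiableM.
  rewrite (_ : partial i _ = f * partial i g + g * partial i f).
    by apply: flat_algebra_add; exact: flat_algebra_mul.
  by apply/funext => x; rewrite /partial deriveM//; exact: diff_derivable.
- have D q t : differentiable (flat q : R -> R) t.
    by apply/derivable1_diffP; have [] := is_derive_flat q t.
  have A := differentiable_affine_coord.
  split=> [x|i]; first exact: (differentiable_comp (A x j a b)).
  set q := 'X^2 * (p - p^`()).
  rewrite (_ : partial i _ =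
      cst (a * (delta_mx ord0 i : 'rV[R]_N) ord0 j) * (fun x => flat q (a * x ord0 j + b))).
    by apply: flat_algebra_mul; [exact: flat_algebra_cst|exact: flat_algebra_flat].
  apply/funext => x; rewrite /partial.
  rewrite deriveE; last exact: (differentiable_comp (A x j a b)).
  rewrite (diff_comp (A x j a b) (D p _))/=.
  have -> : 'd (fun y : 'rV[R]_N => a * y ord0 j + b) x (delta_mx ord0 i) =
      a * (delta_mx ord0 i : 'rV[R]_N) ord0 j.
    by rewrite -deriveE//; have [] := is_derive_affine_coord x (delta_mx ord0 i) j a b.
  rewrite deriv1E; last by have [] := is_derive_flat p (a * x ord0 j + b).
  by rewrite derive1E; have [_ ->] := is_derive_flat p (a * x ord0 j + b).
Qed.

Lemma flat_algebra_smooth f : flat_algebra f -> smooth f.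
Proof.
move=> Ff s; suff /flat_algebra_partial[] : flat_algebra (foldr partial f s) by [].
by elim: s => //= i s /flat_algebra_partial[].
Qed.

Lemma flat_algebra_prod (I : Type) (s : seq I) (F : I -> 'rV[R]_N -> R) :
  (forall i, flat_algebra (F i)) -> flat_algebra (fun x => \prod_(i <- s) F i x).
Proof.
move=> FF; elim: s => [|i s IH].
  by under eq_fun do rewrite big_nil; exact: flat_algebra_cst.
by under eq_fun do rewrite big_cons; exact: flat_algebra_mul.
Qed.

Lemma flat1_gt0 (t : R) : (0 < flat 1 t) = (0 < t).
Proof. by rewrite /flat; case: ifP => [t0|//]; rewrite ?ltxx// hornerC mul1r expR_gt0. Qed.

Lemma flat1_ge0 (t : R) : 0 <= flat 1 t.
Proof.
have [t0|t0] := ltP 0 t; first by rewrite ltW// flat1_gt0.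
by rewrite flat_le0.
Qed.

(** Positive exactly on the open cube of half-side [d] about [c]. The coefficients [1] and [-1] fit
    the generators of [flat_algebra]. *)
Definition bump (c : 'rV[R]_N) (d : R) (x : 'rV[R]_N) : R :=
  \prod_(j < N) (flat 1 (1 * x ord0 j + (d - c ord0 j)) *
                 flat 1 (-1 * x ord0 j + (d + c ord0 j))).

Lemma bump_ge0 c d x : 0 <= bump c d x.
Proof. by apply: prodr_ge0 => j _; rewrite mulr_ge0 ?flat1_ge0. Qed.

Lemma bump_neq0 c d x :
  (bump c d x != 0) <-> forall j, `|x ord0 j - c ord0 j| < d.
Proof.
rewrite /bump; split=> [/prodf_neq0 H j|H].
  have := H j isT; rewrite mulf_eq0 negb_or ltr_norml => /andP[].
  by rewrite !neq_lt !ltNge !flat1_ge0/= -!ltNge !flat1_gt0 => ? ?; apply/andP; split; lra.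
apply/prodf_neq0 => j _; rewrite mulf_neq0// gt_eqF// flat1_gt0.
  by have := H j; rewrite ltr_norml => /andP[? ?]; lra.
by have := H j; rewrite ltr_norml => /andP[? ?]; lra.
Qed.

Lemma test_function_bump c d : test_function (bump c d).
Proof.
split.
  apply/flat_algebra_smooth/flat_algebra_prod => j.
  by apply: flat_algebra_mul; exact: flat_algebra_flat.
apply: (subclosed_compact _ (compact_cube N c d)); first exact: closed_closure.
rewrite [X in _ `<=` X](closure_id _).1; last exact: closed_cube.
by apply: closure_subset => x /bump_neq0 H; apply/cubeP => j; exact/ltW/H.
Qed.

End bump.

(** * Partial integration for the Lebesgue measure *)

Section leb_measure.
Context {R : realType}.

Lemma measurable_box n (A : 'I_n -> set (measurableTypeR R)) :
  (forall i, measurable (A i)) ->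
  measurable [set x : 'rV[R]_n | forall i, A i (x ord0 i)].
Proof.
move=> mA; rewrite (_ : [set x | _] = \big[setI/setT]_(i < n)
    (setT `&` (fun x : 'rV[R]_n => x ord0 i) @^-1` A i)).
  by apply: bigsetI_measurable => i _; exact: measurable_coor.
rewrite -bigcap_seq; apply/seteqP; split => x /= Ax i.
  by move=> _; split => //; exact: Ax.
by have [] := Ax i (mem_index_enum i).
Qed.

Lemma measurable_cube n (c : 'rV[R]_n) d : measurable (cube n c d).
Proof. by apply: (measurable_box n (fun i => `[c ord0 i - d, c ord0 i + d]%classic)). Qed.

Lemma leb_cube n (c : 'rV[R]_n) d : 0 <= d -> leb R n (cube n c d) = ((d *+ 2) ^+ n)%:E.
Proof.
move=> d0; rewrite (@leb_box R n (fun i => `[c ord0 i - d, c ord0 i + d]%classic))//.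
rewrite (eq_bigr (fun=> (d *+ 2)%:E)) => [|i _].
  by rewrite prodEFin prodr_const card_ord.
rewrite lebesgue_measure_itv/= lte_fin; case: ifPn => [_|].
  by rewrite EFinN -EFinD; congr EFin; rewrite mulr2n; ring.
by rewrite -leNgt => H; congr EFin; lra.
Qed.

Lemma sigma_finite_leb n : sigma_finite setT (leb R n).
Proof.
exists (fun k => cube n 0 k%:R).
  apply/esym/seteqP; split => // x _.
  have [k Hk] : exists k : nat, forall i, `|x ord0 i| <= k%:R.
    exists (\max_(i < n) Num.bound `|x ord0 i|)%N => i.
    rewrite (le_trans (ltW (archi_boundP _)))// ?normr_ge0//.
    by rewrite ler_nat; exact: (leq_bigmax (F := fun i => Num.bound `|x ord0 i|)).
  by exists k => //; apply/cubeP => i; rewrite mxE subr0.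
by move=> k; split; [exact: measurable_cube|rewrite leb_cube// ltry].
Qed.

(** Bundles sigma-finiteness with the measure, the form in which Fubini's theorem accepts [leb]. *)
Lemma sigma_finite_measureP d (T : measurableType d) (mu : {measure set T -> \bar R}) :
  sigma_finite setT mu ->
  exists m : {sigma_finite_measure set T -> \bar R}, mu = m.
Proof.
move=> sf.
pose H1 := isSFinite.Build _ _ _ _ (sfinite_measure_sigma_finite sf).
pose H2 := isSigmaFinite.Build _ _ _ _ sf.
exists (HB.pack_for (SigmaFiniteMeasure.type T R) (Measure.sort mu) H1 H2).
exact: eq_measure.
Qed.

(** An open set is the union of those cubes [C p] that it contains; their centres are rational, so
    there are countably many. *)
Lemma open_measurable_rV n (A : set 'rV[R]_n) : open A -> measurable A.
Proof.
move=> oA.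
pose C (p : nat * {ffun 'I_n -> int}) : set 'rV[R]_n :=
  cube n (\row_i ((p.2 i)%:~R / p.1.+1%:R)) p.1.+1%:R^-1.
have mC p : measurable (C p) by exact: measurable_cube.
rewrite (_ : A = \bigcup_p (if `[< C p `<=` A >] then C p else set0)).
  apply: countable_bigcupT_measurable => // p.
  by case: ifP => // _; exact: measurable0.
apply/seteqP; split=> [x Ax|x [p _]]; last by case: ifP => // /asboolP; exact.
move: oA; rewrite openE => /(_ x Ax)/nbhs_ballP[e /= e0 He].
(* Two points of a cube of half-side [k.+1%:R^-1] are less than [e] apart, so a grid cube through
   [x] lies in the ball. Rounding the coordinates of [x] down to the grid supplies its centre. *)
pose k := Num.bound (2 / e).
have ke : 2 * k.+1%:R^-1 < e.
  rewrite ltr_pdivrMr// mulrC -ltr_pdivrMr// (lt_trans (archi_boundP _)) ?ltr_nat//.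
  by rewrite divr_ge0// ltW.
have k0 : 0 < k.+1%:R :> R by [].
pose p : nat * {ffun 'I_n -> int} := (k, [ffun i => Num.floor (x ord0 i * k.+1%:R)]).
have near_x i : `|x ord0 i - (p.2 i)%:~R / p.1.+1%:R| <= k.+1%:R^-1.
  rewrite /= ffunE -[X in `|X - _|](mulfK (lt0r_neq0 k0)) -mulrBl normrM.
  rewrite (gtr0_norm (_ : 0 < k.+1%:R^-1)) ?invr_gt0// ler_piMl ?invr_ge0//.
  have /andP[] := floor_itv (x ord0 i * k.+1%:R); rewrite intrD => f1 f2.
  by rewrite ler_norml; apply/andP; split; lra.
have CA : C p `<=` A.
  move=> y /cubeP Cy; apply: He; split=> // a i; rewrite (ord1 a) /ball/=.
  have := Cy i; have := near_x i; rewrite mxE distrC => H1 H2.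
  rewrite (le_lt_trans _ ke)// -(subrKA ((p.2 i)%:~R / p.1.+1%:R)).
  rewrite (le_trans (ler_normD _ _))// mulr_natl mulr2n lerD// distrC//.
exists p => //; rewrite ifT; last exact/asboolP.
by apply/cubeP => i; rewrite mxE; exact: near_x.
Qed.

Lemma continuous_measurable_rV n (f : 'rV[R]_n -> R) : continuous f ->
  measurable_fun setT (f : 'rV[R]_n -> measurableTypeR R).
Proof.
move=> /continuousP cf; apply: (measurability _ (measurable_realfun.RGenOpens.measurableE R)).
move=> _ [_ [a [b ->] <-]]; rewrite setTI; apply: open_measurable_rV.
exact/cf/interval_open.
Qed.

End leb_measure.

(** * Integrability and Fubini's theorem on row vectors *)

Section leb_integral.
Context {R : realType}.
Notation lambda := (lebesgue_measure : {measure set (measurableTypeR R) -> \bar R}).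

Lemma integrable_cube n (f : 'rV[R]_n -> R) (c : 'rV[R]_n) (d C : R) : 0 <= d ->
  measurable_fun setT (f : 'rV[R]_n -> measurableTypeR R) -> (forall x, `|f x| <= C) ->
  (forall x, ~ cube n c d x -> f x = 0) ->
  (leb R n).-integrable setT (EFin \o f).
Proof.
move=> d0 mf fC f0.
have -> : EFin \o f = (EFin \o f) \_ (cube n c d).
  apply/funext => x; rewrite patchE; case: ifPn => // /negP xc.
  by rewrite /= f0// => cx; apply: xc; rewrite inE.
apply/(integrable_mkcond _ (measurable_cube n c d)).
apply: measurable_bounded_integrable.
- exact: measurable_cube.
- by rewrite leb_cube// ltry.
- exact: measurable_funTS.
- by exists C; split; [exact: num_real|move=> M CM x _; exact: le_trans (fC x) (ltW CM)].
Qed.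

Lemma fubini_cons n (m : {sigma_finite_measure set 'rV[R]_n -> \bar R})
    (g : 'rV[R]_n.+1 -> \bar R) :
  (leb_cons m).-integrable setT g ->
  (\int[leb_cons m]_x g x = \int[lambda]_t \int[m]_y g (cons_rV (t, y)) /\
   \int[leb_cons m]_x g x = \int[m]_y \int[lambda]_t g (cons_rV (t, y)))%E.
Proof.
move=> /integrableP[mg ig].
have mc := @measurable_cons_rV R n.
have mk : measurable_fun setT (g \o @cons_rV R n) by apply: measurableT_comp.
have ik : ((lambda \x^ m).-integrable setT (g \o @cons_rV R n))%E.
  apply/integrableP; split => //.
  move: ig; rewrite (ge0_integral_pushforward mc)//.
  by apply: measurableT_comp.
(* The two constructions of the product measure agree on rectangles, hence everywhere, so
   integrability passes from one to the other. *)
have ik' : ((lambda \x m).-integrable setT (g \o @cons_rV R n))%E.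
  apply/integrableP; split => //; have /integrableP[_] := ik.
  congr (_ < _)%E; apply: eq_measure_integral => A mA _; apply/esym.
  by apply: product_measure_unique => // B D mB mD /=; rewrite product_measure2E.
have E : (\int[leb_cons m]_x g x = \int[lambda \x^ m]_p (g \o @cons_rV R n) p)%E.
  by rewrite (integral_pushforward mc).
by rewrite E; split; [rewrite -integral12_prod_meas2|rewrite -integral21_prod_meas2].
Qed.

Lemma fubini_leb n (g : 'rV[R]_n.+1 -> \bar R) :
  (leb R n.+1).-integrable setT g ->
  (\int[leb R n.+1]_x g x = \int[lambda]_t \int[leb R n]_y g (cons_rV (t, y)) /\
   \int[leb R n.+1]_x g x = \int[leb R n]_y \int[lambda]_t g (cons_rV (t, y)))%E.
Proof.
rewrite -[leb R n.+1]/(leb_cons (leb R n)).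
have [m ->] := sigma_finite_measureP _ _ (leb R n) (sigma_finite_leb n).
exact: fubini_cons.
Qed.

End leb_integral.

(** * Vanishing integrals of compactly supported derivatives *)

Section integral_partial.
Context {R : realType}.

Lemma integral_derive0 (f df : R -> R) (m : R) : 0 <= m ->
  (forall t : R, is_derive t 1 f (df t)) -> continuous df ->
  (forall t, m < `|t| -> f t = 0 /\ df t = 0) ->
  (\int[@lebesgue_measure R]_t (df t)%:E = 0)%E.
Proof.
move=> m0 Df cdf f0.
(* The interval is enlarged by [1] because [f] is only known to vanish strictly beyond [m]; at both
   new end points it is [0]. *)
have -> : (fun t => (df t)%:E) = (fun t => (df t)%:E) \_ `[- (m + 1), m + 1].
  apply/funext => t; rewrite patchE; case: ifPn => // /negP tm.
  rewrite (f0 t _).2// ltNge; apply/negP => H; apply: tm.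
  by rewrite inE/= in_itv/= -ler_norml (le_trans H)// lerDl.
rewrite -integral_mkcond (@continuous_FTC2 _ df f).
- rewrite !(f0 _ _).1 ?subee// ?normrN gtr0_norm ?ltrDl//; lra.
- lra.
- exact: continuous_subspaceT.
- have cf : continuous f.
    by move=> t; apply/differentiable_continuous/derivable1_diffP; have [] := Df t.
  split; [by move=> t _; have [] := Df t|..].
    exact/cvg_at_right_filter/cf.
  exact/cvg_at_left_filter/cf.
- by move=> t _; rewrite derive1E; have [_ ->] := Df t.
Qed.

Lemma cons_rV_ord0 n (t : R) (y : 'rV[R]_n) : cons_rV (t, y) ord0 ord0 = t.
Proof.
rewrite /cons_rV (_ : (ord0 : 'I_n.+1) = @lshift 1 n ord0); last exact/val_inj.
by rewrite (row_mxEl (t%:M : 'rV[R]_1)) mxE eqxx.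
Qed.

Lemma cons_rV_lift n (t : R) (y : 'rV[R]_n) j :
  cons_rV (t, y) ord0 (lift ord0 j) = y ord0 j.
Proof.
rewrite /cons_rV (_ : lift ord0 j = @rshift 1 n j); last exact/val_inj.
by rewrite (row_mxEr (t%:M : 'rV[R]_1)).
Qed.

Lemma cons_rVDl n (t s : R) (y : 'rV[R]_n) :
  cons_rV (t, y) + s *: delta_mx ord0 ord0 = cons_rV (t + s, y).
Proof.
apply/rowP => j; rewrite mxE [X in _ + X]mxE [X in _ * X]mxE.
case: (unliftP ord0 j) => [k|] ->; first by rewrite !cons_rV_lift mulr0 addr0.
by rewrite !cons_rV_ord0 !eqxx mulr1.
Qed.

(** The increment stands on the left, as in the difference quotients that define [derive]. *)
Lemma cons_rVDr n (t s : R) (y : 'rV[R]_n) k :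
  s *: delta_mx ord0 (lift ord0 k) + cons_rV (t, y) =
  cons_rV (t, s *: delta_mx ord0 k + y).
Proof.
apply/rowP => j; rewrite mxE [X in X + _]mxE [X in _ * X]mxE.
case: (unliftP ord0 j) => [l|] ->.
  by rewrite !cons_rV_lift !mxE !eqxx (inj_eq (@lift_inj _ _)).
by rewrite !cons_rV_ord0 mulr0 add0r.
Qed.

Lemma continuous_cons_rV n (t : R) :
  continuous (fun y : 'rV[R]_n => cons_rV (t, y) : 'rV[R]_n.+1).
Proof.
move=> y A /nbhs_ballP[e e0 He]; apply/nbhs_ballP; exists e => // z [_ yz].
apply: He; split => // a j; rewrite !(ord1 a); case: (unliftP ord0 j) => [k|] ->.
  by rewrite !cons_rV_lift; exact: yz.
by rewrite !cons_rV_ord0; exact: ballxx.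
Qed.

Lemma cube_cons_rV n (t m : R) (y : 'rV[R]_n) :
  cube n.+1 0 m (cons_rV (t, y)) <-> `|t| <= m /\ cube n 0 m y.
Proof.
split=> [/cubeP H|[tm /cubeP H]].
  split; first by have := H ord0; rewrite cons_rV_ord0 mxE subr0.
  by apply/cubeP => i; have := H (lift ord0 i); rewrite cons_rV_lift mxE [in X in _ -> X]mxE.
apply/cubeP => i; case: (unliftP ord0 i) => [k|] ->.
  by have := H k; rewrite cons_rV_lift mxE [in X in _ -> X]mxE.
by rewrite cons_rV_ord0 mxE subr0.
Qed.

(** Induction on the dimension, splitting off the first coordinate by Fubini. If [i] is a later
    coordinate, each slice with fixed first coordinate integrates to [0] by induction; if [i] is the
    first, the order is swapped and the inner integral is one-dimensional. *)
Lemma integral_partial0 n (F : 'rV[R]_n -> R) (i : 'I_n) (m C : R) : 0 <= m ->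
  (forall x, derivable F x (delta_mx ord0 i)) -> continuous (partial i F) ->
  (forall x, `|partial i F x| <= C) ->
  (forall x, ~ cube n 0 m x -> F x = 0 /\ partial i F x = 0) ->
  (\int[leb R n]_x (partial i F x)%:E = 0)%E.
Proof.
move=> m0; elim: n F i => [|n IH] F i; first by case: i.
move=> dF cF bF F0.
have [|E1 E2] := @fubini_leb R n (EFin \o partial i F).
  apply: (integrable_cube _ _ 0 m C) => //; first exact: continuous_measurable_rV.
  by move=> x /F0[].
case: (unliftP ord0 i) => [k|] ik.
  rewrite E1 integral0_eq// => t _.
  have PE y : partial i F (cons_rV (t, y)) = partial k (fun y => F (cons_rV (t, y))) y.
    by rewrite /partial /derive/= ik; under [in RHS]eq_fun do rewrite -cons_rVDr.
  under eq_integral do rewrite /= PE; apply: IH => [y||y|y ym].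
  - have := dF (cons_rV (t, y)); rewrite /derivable/= ik.
    by under [in X in _ -> X]eq_fun do rewrite -cons_rVDr.
  - rewrite (_ : partial k _ = partial i F \o (fun y => cons_rV (t, y))).
      by move=> y; apply: continuous_comp (cF _); exact: continuous_cons_rV.
    by apply/funext => y; rewrite /= PE.
  - by rewrite -PE.
  - by rewrite -PE; apply: F0 => /cube_cons_rV[].
rewrite E2 integral0_eq// => y _.
apply: (integral_derive0 (fun t => F (cons_rV (t, y))) _ m) => // [t|t|t tm].
- have -> : (fun t => F (cons_rV (t, y))) =
      (fun s => F (cons_rV (0, y) + s *: delta_mx ord0 ord0)).
    by apply/funext => s; rewrite cons_rVDl add0r.
  apply: is_derive_line; rewrite cons_rVDl add0r /partial ik.
  by apply: derivableP; have := dF (cons_rV (t, y)); rewrite ik.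
- have H : {for t, continuous
      (fun t : R => cons_rV (0, y) + t *: delta_mx ord0 ord0 : 'rV[R]_n.+1)}.
    apply: continuousD; first exact: cst_continuous.
    by apply: scalel_continuous.
  have -> : (fun t => partial i F (cons_rV (t, y))) =
      partial i F \o (fun t : R => cons_rV (0, y) + t *: delta_mx ord0 ord0).
    by apply/funext => s; rewrite /= cons_rVDl add0r.
  by apply: continuous_comp => //; exact: cF.
- by apply: F0 => /cube_cons_rV[]; rewrite leNgt tm.
Qed.

End integral_partial.

(** * From distributional to pointwise equations *)

Section distributions_to_pointwise.
Context {R : realType} {n : nat}.
Implicit Types (f g phi u : 'rV[R]_n -> R) (c x : 'rV[R]_n).

Lemma continuous_opp f : continuous f -> continuous (fun x => - f x).
Proof. by move=> cf x; exact: (@continuousN _ _ _ f x (cf x)). Qed.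

Lemma continuous_sub f g :
  continuous f -> continuous g -> continuous (fun x => f x - g x).
Proof. by move=> cf cg x; exact: (@continuousB _ _ _ f g x (cf x) (cg x)). Qed.

Lemma continuous_mul f g :
  continuous f -> continuous g -> continuous (fun x => f x * g x).
Proof. by move=> cf cg x; exact: (@continuousM _ _ f g x (cf x) (cg x)). Qed.

Lemma partial_out_cube f (i : 'I_n) (m : R) :
  (forall x, ~ cube n 0 m x -> f x = 0) ->
  forall x, ~ cube n 0 m x -> partial i f x = 0.
Proof.
move=> f0 x xm; rewrite /partial (@near_eq_derive _ _ _ f (cst 0)) ?derive_cst//.
have : open (~` cube n 0 m) by apply: closed_openC; exact: closed_cube.
rewrite openE => /(_ x xm); apply: filterS => y ym; exact: f0.
Qed.

Lemma bounded_out_cube f (m : R) : 0 <= m -> continuous f ->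
  (forall x, ~ cube n 0 m x -> f x = 0) -> exists C, forall x, `|f x| <= C.
Proof.
move=> m0 cf f0.
have K0 : cube n 0 m !=set0 by exists 0; apply/cubeP => i; rewrite subrr normr0.
have cnf : continuous (fun x => `|f x|).
  by move=> x; apply: continuous_comp (cf x) (@norm_continuous _ _ _).
have [x _ xmax] := EVT_max_rV K0 (compact_cube n 0 m) (continuous_subspaceT cnf).
exists `|f x| => y; have [ym|ym] := pselect (cube n 0 m y).
  by apply: xmax; rewrite inE.
by rewrite f0// normr0.
Qed.

Lemma integrable_out_cube f (m : R) : 0 <= m -> continuous f ->
  (forall x, ~ cube n 0 m x -> f x = 0) -> (leb R n).-integrable setT (EFin \o f).
Proof.
move=> m0 cf f0; have [C fC] := bounded_out_cube f m m0 cf f0.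
by apply: (integrable_cube _ _ 0 m C) => //; exact: continuous_measurable_rV.
Qed.

Lemma continuous_laplacian u : smooth u -> continuous (laplacian u).
Proof.
move=> su x; have -> : laplacian u = \sum_(i < n) partial i (partial i u).
  by apply/funext => y; rewrite /laplacian fct_sumE.
by apply/differentiable_continuous/differentiable_sum => i; exact: (su [:: i; i]).
Qed.

(** The field [F], that is [phi] times the gradient of [u] minus [u] times the gradient of [phi],
    vanishes outside the cube and has divergence [phi * laplacian u - u * laplacian phi]; each
    summand of the divergence integrates to [0]. *)
Lemma green_identity u phi (m : R) : 0 <= m -> smooth u -> smooth phi ->
  (forall x, ~ cube n 0 m x -> phi x = 0) ->
  (\int[leb R n]_x (u x * - laplacian phi x) =
   \int[leb R n]_x (- laplacian u x * phi x))%R.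
Proof.
move=> m0 su sphi phi0.
have phi1 i := partial_out_cube phi i m phi0.
have phi2 i := partial_out_cube _ i m (phi1 i).
have cu := smooth_continuous u su.
have cphi := smooth_continuous phi sphi.
have cu2 := continuous_laplacian u su; have cphi2 := continuous_laplacian phi sphi.
pose F (i : 'I_n) : 'rV[R]_n -> R := phi * partial i u - u * partial i phi.
have dF i x : is_derive x (delta_mx ord0 i) (F i)
    (phi x * partial i (partial i u) x - u x * partial i (partial i phi) x).
  have ? := smooth_is_derive u i x su; have ? := smooth_is_derive phi i x sphi.
  have ? := smooth_is_derive _ i x (smooth_partial u i su).
  have ? := smooth_is_derive _ i x (smooth_partial phi i sphi).
  apply: is_derive_eq; rewrite /GRing.scale/=.
  move: (phi x) (u x) (partial i phi x) (partial i u x) => a b a1 b1.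
  by move: (partial i (partial i phi) x) (partial i (partial i u) x) => a2 b2; ring.
have pF i : partial i (F i) =
    phi * partial i (partial i u) - u * partial i (partial i phi).
  by apply/funext => x; rewrite /partial (@derive_val _ _ _ _ _ _ _ (dF i x)).
have cpF i : continuous (partial i (F i)).
  rewrite pF => x; apply/differentiable_continuous/differentiableB.
    exact: (differentiableM (sphi [::] x) (su [:: i; i] x)).
  exact: (differentiableM (su [::] x) (sphi [:: i; i] x)).
have F0 i x : ~ cube n 0 m x -> F i x = 0 /\ partial i (F i) x = 0.
  by move=> xm; rewrite pF /F !fctE phi0// phi1// phi2// !mul0r !mulr0 subrr.
have iF i : (\int[leb R n]_x (partial i (F i) x)%:E = 0)%E.
  have [C FC] := bounded_out_cube _ m m0 (cpF i) (fun x xm => (F0 i x xm).2).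
  apply: (integral_partial0 _ _ _ m C) => // x xm; exact: F0.
apply/eqP; rewrite -subr_eq0; apply/eqP.
rewrite -RintegralB//; last 2 first.
- apply: (integrable_out_cube _ m m0 (continuous_mul _ _ cu (continuous_opp _ cphi2))).
  by move=> x xm; rewrite /laplacian big1 ?oppr0 ?mulr0// => i _; exact: phi2.
- apply: (integrable_out_cube _ m m0 (continuous_mul _ _ (continuous_opp _ cu2) cphi)).
  by move=> x xm; rewrite phi0 ?mulr0.
rewrite /Rintegral (eq_integral (fun x => \sum_(i < n) (partial i (F i) x)%:E)%E).
  rewrite integral_sum//; first by rewrite big1.
  by move=> i; apply: (integrable_out_cube _ m) => // x xm; exact: (F0 i x xm).2.
move=> x _; rewrite sumEFin; congr EFin.
rewrite (eq_bigr (fun i => phi x * partial i (partial i u) x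
     - u x * partial i (partial i phi) x)); last by move=> i _; rewrite pF.
have -> : \sum_(i < n) (phi x * partial i (partial i u) x
    - u x * partial i (partial i phi) x) = phi x * laplacian u x - u x * laplacian phi x.
  by rewrite sumrB /laplacian !mulr_sumr.
move: (laplacian u x) (laplacian phi x) (u x) (phi x) => a b p q.
by rewrite mulrN mulNr opprK addrC [a * _]mulrC.
Qed.

(** The integration lemmas use cubes centred at [0]; adding all [|c_j|] to the half-side makes such
    a cube large enough. *)
Lemma bump_out_cube c (d : R) : 0 < d -> exists2 m, 0 <= m &
  forall x, ~ cube n 0 m x -> bump c d x = 0.
Proof.
move=> d0; exists (d + \sum_(j < n) `|c ord0 j|).
  by rewrite addr_ge0 ?sumr_ge0// ltW.
move=> x xm; apply/eqP; apply/negP => /negP/bump_neq0 H; apply: xm.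
apply/cubeP => j; rewrite mxE subr0 -(subrK (c ord0 j) (x ord0 j)).
rewrite (le_trans (ler_normD _ _))// lerD ?(ltW (H j))//.
by rewrite (bigD1 j)//= lerDl sumr_ge0.
Qed.

Lemma continuous_bump c (d : R) : continuous (bump c d).
Proof. by have [/smooth_continuous] := test_function_bump c d. Qed.

(** If [f c > 0], then [f] is positive on an open cube about [c]. Its product with the bump on that
    cube is nonnegative with zero integral, hence zero almost everywhere, yet it is positive on the
    cube of half the size, which has positive measure. *)
Lemma fundamental_lemma_le0 f : continuous f ->
  (forall c d, 0 < d -> (\int[leb R n]_x (f x * bump c d x))%R = 0) ->
  forall x, f x <= 0.
Proof.
move=> cf f0 c; rewrite leNgt; apply/negP => fc.
have : \forall x \near c, 0 < f x by exact: (cvgr_gt _ (cf c)).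
move=> /nbhs_ballP[e /= e0 He].
pose h x := f x * bump c e x.
have h0 x : 0 <= h x.
  rewrite /h; have [->|] := eqVneq (bump c e x) 0; first by rewrite mulr0.
  move=> /bump_neq0 H; rewrite mulr_ge0 ?bump_ge0// ltW//; apply: He.
  by split => // a j; rewrite (ord1 a) /ball/= distrC.
have [m m0 hm] := bump_out_cube c e e0.
have ch : continuous h.
  exact: continuous_mul cf (continuous_bump c e).
have hI : (leb R n).-integrable setT (EFin \o h).
  by apply: (integrable_out_cube _ m) => // x xm; rewrite /h hm// mulr0.
have : (\int[leb R n]_x `|(EFin \o h) x| = 0)%E.
  under eq_integral do rewrite gee0_abs ?lee_fin//.
  by rewrite -[LHS]fineK ?integrable_fin_num//; congr EFin; exact: f0.
move=> /ae_eq_integral_abs[]//.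
  exact: measurable_int hI.
move=> B [mB B0 hB].
have : (leb R n (cube n c (e / 2)) <= leb R n B)%E.
  apply: le_measure; rewrite ?inE//; first exact: measurable_cube.
  move=> x /cubeP xc; apply: hB => /= H.
  have xe j : `|x ord0 j - c ord0 j| < e by rewrite (le_lt_trans (xc j))//; lra.
  have /eqP : h x = 0 by have [] := H I.
  rewrite mulf_eq0 (negbTE (_ : bump c e x != 0)) ?orbF; last exact/bump_neq0.
  rewrite gt_eqF//; apply: He.
  by split => // a j; rewrite (ord1 a) /ball/= distrC.
rewrite B0 leb_cube ?divr_ge0 ?(ltW e0)// lee_fin leNgt exprn_gt0//; lra.
Qed.

Lemma fundamental_lemma f : continuous f ->
  (forall c d, 0 < d -> (\int[leb R n]_x (f x * bump c d x))%R = 0) ->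
  forall x, f x = 0.
Proof.
move=> cf f0 x; apply/eqP; rewrite eq_le fundamental_lemma_le0//=.
rewrite -oppr_le0; apply: (fundamental_lemma_le0 (- f)).
  exact: continuous_opp.
move=> c d d0; have [m m0 hm] := bump_out_cube c d d0.
have fI : (leb R n).-integrable setT (EFin \o (fun x => f x * bump c d x)).
  apply: (integrable_out_cube _ m m0 (continuous_mul _ _ cf (continuous_bump c d))).
  by move=> y ym; rewrite hm// mulr0.
under eq_Rintegral do rewrite mulNr -mulN1r.
by rewrite RintegralZl// f0// mulr0.
Qed.

Lemma ae_eq_Rintegral f g : measurable_fun setT (f : _ -> measurableTypeR R) ->
  measurable_fun setT (g : _ -> measurableTypeR R) ->
  {ae leb R n, forall x, f x = g x} ->
  (\int[leb R n]_x f x = \int[leb R n]_x g x)%R.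
Proof.
move=> mf mg fg; congr fine; apply: ae_eq_integral => //;
  [exact/measurable_EFinP|exact/measurable_EFinP|].
by apply: filterS fg => x /= -> .
Qed.

Lemma distr_sol_pointwise u us g gs : smooth us -> continuous gs ->
  measurable_fun setT (u : _ -> measurableTypeR R) ->
  measurable_fun setT (g : _ -> measurableTypeR R) ->
  {ae leb R n, forall x, u x = us x} -> {ae leb R n, forall x, g x = gs x} ->
  distr_sol_minus_laplacian u g -> forall x, - laplacian us x = gs x.
Proof.
move=> sus cgs mu mg uus ggs sol x; apply/eqP; rewrite -subr_eq0; apply/eqP.
have cl := continuous_laplacian us sus.
move: x; apply: fundamental_lemma.
  by move=> x; exact: (continuousB (continuous_opp _ cl x) (cgs x)).
move=> c d d0; have [m m0 hm] := bump_out_cube c d d0.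
have tb := test_function_bump c d; have cb := continuous_bump c d.
have cb2 := continuous_laplacian _ tb.1.
under eq_Rintegral do rewrite mulrBl.
rewrite RintegralB//; last 2 first.
- apply: (integrable_out_cube _ m m0 (continuous_mul _ _ (continuous_opp _ cl) cb)).
  by move=> y ym; rewrite hm// mulr0.
- apply: (integrable_out_cube _ m m0 (continuous_mul _ _ cgs cb)).
  by move=> y ym; rewrite hm// mulr0.
(* Back on the bump, the Laplacian no longer acts on [us], so [us] and [gs] can be replaced by [u]
   and [g] off a null set and the distributional equation applies. *)
rewrite -(green_identity _ _ m)//; last exact: tb.1.
have ml : measurable_fun setT ((fun x => - laplacian (bump c d) x) : _ -> measurableTypeR R).
  exact: continuous_measurable_rV (continuous_opp _ cb2).
have mb := continuous_measurable_rV _ _ cb.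
have mus := continuous_measurable_rV _ _ (smooth_continuous _ sus).
have mgs := continuous_measurable_rV _ _ cgs.
rewrite -(ae_eq_Rintegral (fun x => u x * - laplacian (bump c d) x)); last 3 first.
- exact: measurable_funM.
- exact: measurable_funM.
- by apply: filterS uus => y ->.
rewrite -(ae_eq_Rintegral (fun x => g x * bump c d x) (fun x => gs x * _)); last 3 first.
- exact: measurable_funM.
- exact: measurable_funM.
- by apply: filterS ggs => y ->.
by rewrite sol// subrr.
Qed.

End distributions_to_pointwise.

(** * Rigidity for smooth representatives of distributional solutions *)

Theorem theorem1p6 (R : realType) (Lambda : R) (N : nat)
    (u v us vs : 'rV[R]_N -> R)
    (Lambda_gt0 : 0 < Lambda) (Lambda_lt1 : Lambda < 1) (N_ge1 : (1 <= N)%N)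
    (sol_uv : is_solution Lambda u v)
    (us_rep : smooth_representative u us)
    (vs_rep : smooth_representative v vs)
    (us_gt0 : forall x, 0 < us x) (vs_gt0 : forall x, 0 < vs x) :
  forall x, us x = 1 / Num.sqrt (1 + Lambda) /\
            vs x = 1 / Num.sqrt (1 + Lambda).
Proof.
have [sus uus] := us_rep; have [svs vvs] := vs_rep.
have [[mu _] [mv _] solu solv] := sol_uv.
have cu := smooth_continuous us sus; have cv := smooth_continuous vs svs.
have ccst : continuous (fun _ : 'rV[R]_N => Lambda) by exact: cst_continuous.
apply: coupled_liouville => //.
- apply: (distr_sol_pointwise u us _ _ sus _ mu _ uus _ solu).
  (* The powers are treated as the iterated products to which they are convertible. *)
  + exact: (continuous_sub _ _ (continuous_sub _ _ cu (continuous_mul _ _ cu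
      (continuous_mul _ _ cu cu))) (continuous_mul _ _ (continuous_mul _ _ ccst cu)
      (continuous_mul _ _ cv cv))).
  + apply: measurable_funB; first by apply: measurable_funB => //; exact: measurable_funX.
    apply: measurable_funM; first exact: measurable_funM.
    exact: measurable_funX.
  + by apply: filterS2 uus vvs => x -> ->.
- apply: (distr_sol_pointwise v vs _ _ svs _ mv _ vvs _ solv).
  + exact: (continuous_sub _ _ (continuous_sub _ _ cv (continuous_mul _ _ cv
      (continuous_mul _ _ cv cv))) (continuous_mul _ _ (continuous_mul _ _ ccst
      (continuous_mul _ _ cu cu)) cv)).
  + apply: measurable_funB; first by apply: measurable_funB => //; exact: measurable_funX.
    apply: measurable_funM => //; apply: measurable_funM => //.
    exact: measurable_funX.
  + by apply: filterS2 uus vvs => x -> ->.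
Qed.
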